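(* Properties (i)--(ii) below do not suffice for exactness of the two-phase label-setting procedure, and the error can be arbitrarily large: for every $M>0$ there exist an EVRPTWNL instance with dual values $(\kappa,\mu,\nu)$ and domination relations $\succeq$ on feasible partial subpaths and on feasible partial paths satisfying (i) if $s_1,s_2$ are feasible partial subpaths with $s_1\succeq s_2$, $a\in\mathcal A$ extends both, and $s_2\oplus a$ is feasible, then $s_1\oplus a$ is feasible and $s_1\oplus a\succeq s_2\oplus a$; (ii) if $p_1,p_2$ are feasible partial paths with $p_1\succeq p_2$, $s$ is a subpath extending both, and $p_2\oplus s$ is feasible, then $p_1\oplus s$ is feasible and $p_1\oplus s\succeq p_2\oplus s$; such that there exists a feasible path of reduced cost at most $-M$, but the two-phase procedure (FindNonDominatedSubpaths, followed by FindNonDominatedPaths applied to its output) run with these domination relations returns no path of negative reduced cost.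
   Context: **Instance.** $(\mathcal V,\mathcal A)$ is a finite directed graph, $\mathcal V=\mathcal V_C\cup\mathcal V_D\cup\mathcal V_S$ a partition into customers, depots and charging stations; $T$ is the time horizon, $B$ the battery capacity, $D$ the vehicle capacity. Each arc $(i,j)$ has travel time $t_{i,j}>0$, cost $c_{i,j}>0$, battery use $b_{i,j}>0$. Each node $i$ has demand $d_i\ge 0$ and time window $[\alpha_i,\beta_i]\subseteq[0,T]$; for $i\in\mathcal V_D\cup\mathcal V_S$, $d_i=0$, $\alpha_i=0$, $\beta_i=T$. The charging function $g:\mathbb R_+\to[0,B]$ is concave, increasing, $g(0)=0$, and invertible: it is continuous, strictly increasing until it attains $B$, and $g^{-1}(b)$ is the smallest $t$ with $g(t)=b$. Set $g_C(b,t)=g(g^{-1}(b)+t)$. **Subpaths.** A partial subpath $s$ is a node sequence $(n_0,\dots,n_m)$ along arcs with $n_0\in\mathcal V_D\cup\mathcal V_S$ and $n_1,\dots,n_{m-1}\in\mathcal V_C$; it is a (complete) subpath if moreover $m\ge1$ and $n_m\in\mathcal V_D\cup\mathcal V_S$. It is feasible if there is $(t_0,b_0)$ such that, with $t_{k+1}=\max\{t_k+t_{n_k,n_{k+1}},\alpha_{n_{k+1}}\}$ and $b_{k+1}=b_k-b_{n_k,n_{k+1}}$, one has $\sum_k d_{n_k}\le D$, $b_k\in[0,B]$ and $t_k\in[\alpha_{n_k},\beta_{n_k}]$ for all $k$. An arc $a=(n_m,n')$ extends $s$ to $s\oplus a$. $T^{\rm travel}(s)=\sum_{\ell} t_{n_\ell,n_{\ell+1}}$.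 **Paths.** A partial path $p$ is a node sequence $(n_0,\dots,n_m)$ along arcs with $n_0\in\mathcal V_D$ and $n_1,\dots,n_{m-1}\in\mathcal V_C\cup\mathcal V_S$; it is a (complete) path if $m\ge1$ and $n_m\in\mathcal V_D$. It is feasible if there are charging times $\tau_k\ge0$ ($n_k\in\mathcal V_S$; put $\tau_k=0$ otherwise) such that with $t_0=0$, $b_0=B$, $t_{k+1}=\max\{t_k+\tau_k+t_{n_k,n_{k+1}},\alpha_{n_{k+1}}\}$, and $b_{k+1}=g_C(b_k,\tau_k)-b_{n_k,n_{k+1}}$ if $n_k\in\mathcal V_S$, $b_{k+1}=b_k-b_{n_k,n_{k+1}}$ otherwise, one has $\sum_k d_{n_k}\le D$, $b_k\in[0,B]$, $t_k\in[\alpha_{n_k},\beta_{n_k}]$ for all $k$. Partial paths in the second phase end at non-customer nodes. A subpath $s$ extends $p$ if the end node of $p$ equals the start node of $s$ and is in $\mathcal V_S$ (or $p$ is the single depot node at which $s$ starts); the concatenation is $p\oplus s$. $T^{\rm end}_{\min}(p)$ is the smallest arrival time at the last node over all charging times making $p$ feasible. **Reduced cost.** Given real vectors $\kappa,\mu$ (indexed by $\mathcal V_D$), $\nu$ (indexed by $\mathcal V_C$), the reduced cost $\overline c$ of a (partial) path or subpath is the sum over its arcs of $\overline c_{i,j}=c_{i,j}-\mathbb 1(i\in\mathcal V_D)\kappa_i-\mathbb 1(j\in\mathcal V_D)\mu_j-\mathbb 1(j\in\mathcal V_C)\nu_j$. **Domination.** A domination relation $\succeq$ compares only labels with the same start node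 and the same end node, and is defined by comparing resources (real-valued functions of labels), which include the reduced cost $\overline c$ and a resource that is nonnegative, bounded above and strictly increasing along extensions; thus $\succeq$ is reflexive and transitive and $x\succeq y$ implies $r(x)\le r(y)$ for these two resources $r$. **FindNonDominatedSubpaths.** Start with $\mathcal S_{\rm gen}=\emptyset$ and $\mathcal S_{\rm queue}$ = all single-node partial subpaths at nodes of $\mathcal V_D\cup\mathcal V_S$. While $\mathcal S_{\rm queue}\ne\emptyset$: select $s\in\mathcal S_{\rm queue}$ with smallest $T^{\rm travel}(s)$, move it to $\mathcal S_{\rm gen}$; if $s$ is not complete, then for each arc $a$ extending $s$: if $s\oplus a$ is infeasible or dominated by some element of $\mathcal S_{\rm queue}\cup\mathcal S_{\rm gen}$, discard it; otherwise remove from $\mathcal S_{\rm queue}$ every $s'$ with $s\oplus a\succeq s'$ and add $s\oplus a$. Return the complete subpaths in $\mathcal S_{\rm gen}$. **FindNonDominatedPaths**$(\mathcal S^* )$. Start with $\mathcal P_{\rm gen}=\emptyset$ and $\mathcal P_{\rm queue}$ = all single-node partial paths at depots. While $\mathcal P_{\rm queue}\neq\emptyset$: select $p\in\mathcal P_{\rm queue}$ with smallest $T^{\rm end}_{\min}(p)$, move it to $\mathcal P_{\rm gen}$; if $p$ is not complete, then for each $s\in\mathcal S^*$ extending $p$: if $p\oplus s$ is infeasible or dominated by some element of $\mathcal P_{\rm queue}\cup\mathcal P_{\rm gen}$, discard it; otherwise remove from $\mathcal P_{\rm queue}$ every $p'$ with $p\oplus s\succeq p'$ and add $p\oplus s$.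 Return the complete paths in $\mathcal P_{\rm gen}$. *)

(* Defs.v *)
From mathcomp Require Import all_boot all_order all_algebra.
From mathcomp Require Import all_classical all_reals all_analysis.
Set Implicit Arguments.
Unset Strict Implicit.
Unset Printing Implicit Defensive.
Import Order.TTheory GRing.Theory Num.Theory.
Import numFieldNormedType.Exports.
Local Open Scope classical_set_scope.
Local Open Scope ring_scope.

(* The smallest element of A; 0 if A has none. *)
Definition least (R : realType) (A : set R) : R :=
  xget 0 [set x | A x /\ lbound A x].

(* The values of charge on negative reals are irrelevant. *)
Record charging_function (R : realType) (B : R) := ChargingFunction {
  charge :> R -> R;
  charge_itv : forall x, 0 <= x -> 0 <= charge x <= B;
  charge_concave : convex_function (`[0, +oo[ : set R) (fun x => - charge x);
  charge_homo : {in >= 0 &, {homo charge : x y / x <= y}};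
  charge0 : charge 0 = 0;
  charge_continuous : {within `[0, +oo[, continuous charge};
  charge_strict :
    forall x y, 0 <= x -> x < y -> charge x < B -> charge x < charge y;
  charge_full : exists2 x, 0 <= x & charge x = B
}.

Definition charge_inv (R : realType) (B : R) (g : charging_function B) (b : R)
  : R := least [set x | 0 <= x /\ g x = b].

Definition charge_from (R : realType) (B : R) (g : charging_function B)
  (b tau : R) : R := g (charge_inv g b + tau).

(* Two-argument parameters are only meaningful on arcs. *)
Record instance (R : realType) (V : finType) := Instance {
  arc : rel V;
  customers : {set V};
  depots : {set V};
  stations : {set V};
  nodes_cover : customers :|: depots :|: stations = [set: V]%SET;
  nodes_disjoint : [&& [disjoint customers & depots],
                       [disjoint customers & stations] &
                       [disjoint depots & stations]];
  horizon : R;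
  battery : R;
  capacity : R;
  horizon_gt0 : 0 < horizon;
  battery_gt0 : 0 < battery;
  capacity_ge0 : 0 <= capacity;
  travel : V -> V -> R;
  cost : V -> V -> R;
  consumption : V -> V -> R;
  travel_gt0 : forall i j, arc i j -> 0 < travel i j;
  cost_gt0 : forall i j, arc i j -> 0 < cost i j;
  consumption_gt0 : forall i j, arc i j -> 0 < consumption i j;
  demand : V -> R;
  open_time : V -> R;
  close_time : V -> R;
  demand_ge0 : forall i, 0 <= demand i;
  window_valid :
    forall i, [&& 0 <= open_time i, open_time i <= close_time i &
                  close_time i <= horizon];
  noncustomer_free :
    forall i, i \in depots :|: stations ->
      [/\ demand i = 0, open_time i = 0 & close_time i = horizon];
  charging : charging_function battery
}.

(* A nonempty node sequence n_0, ..., n_m, encoded as (n_0, [:: n_1; ...; n_m]). *)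
Definition label (V : finType) : Type := (V * seq V)%type.

Section Labels.
Variable V : finType.
Implicit Types x y : label V.

Definition singleton (v : V) : label V := (v, [::]).
Definition nb_arcs x : nat := size x.2.
Definition node x (k : nat) : V := nth x.1 (x.1 :: x.2) k.
Definition first_node x : V := x.1.
Definition last_node x : V := last x.1 x.2.
(* The nodes n_1, ..., n_(m-1). *)
Definition inner_nodes x : seq V := behead (belast x.1 x.2).
Definition extend_arc x (v : V) : label V := (x.1, rcons x.2 v).
(* Meaningful when last_node x = first_node y, the node that is merged. *)
Definition concat x y : label V := (x.1, x.2 ++ y.2).

End Labels.

Section Feasibility.
Variables (R : realType) (V : finType) (I : instance R V).
Implicit Types (s p : label V) (i j v : V).

Definition total_travel s : R :=
  \sum_(k < nb_arcs s) travel I (node s k) (node s k.+1).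

Definition total_demand s : R :=
  \sum_(k < (nb_arcs s).+1) demand I (node s k).

(* Time t_k and battery level b_k at the node n_k, for k <= m. *)
Definition within_limits s (t b : nat -> R) : Prop :=
  forall k, (k <= nb_arcs s)%N ->
    (0 <= b k <= battery I) /\
    (open_time I (node s k) <= t k <= close_time I (node s k)).

Definition is_partial_subpath s : bool :=
  [&& path (arc I) s.1 s.2,
      first_node s \in depots I :|: stations I &
      all (mem (customers I)) (inner_nodes s)].

Definition complete_subpath s : bool :=
  (0 < nb_arcs s)%N && (last_node s \in depots I :|: stations I).

Definition subpath_schedule s (t b : nat -> R) : Prop :=
  forall k, (k < nb_arcs s)%N ->
    t k.+1 = Num.max (t k + travel I (node s k) (node s k.+1))
                     (open_time I (node s k.+1)) /\
    b k.+1 = b k - consumption I (node s k) (node s k.+1).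

Definition feasible_subpath s : Prop :=
  [/\ is_partial_subpath s, total_demand s <= capacity I &
      exists t b, subpath_schedule s t b /\ within_limits s t b].

Definition is_partial_path p : bool :=
  [&& path (arc I) p.1 p.2,
      first_node p \in depots I &
      all (mem (customers I :|: stations I)) (inner_nodes p)].

Definition complete_path p : bool :=
  (0 < nb_arcs p)%N && (last_node p \in depots I).

Definition charging_times p (tau : nat -> R) : Prop :=
  forall k, (k <= nb_arcs p)%N ->
    0 <= tau k /\ (node p k \notin stations I -> tau k = 0).

Definition path_schedule p (tau t b : nat -> R) : Prop :=
  [/\ t 0%N = 0, b 0%N = battery I &
      forall k, (k < nb_arcs p)%N ->
        t k.+1 = Num.max (t k + tau k + travel I (node p k) (node p k.+1))
                         (open_time I (node p k.+1)) /\
        b k.+1 = (if node p k \in stations I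
                  then charge_from (charging I) (b k) (tau k) else b k)
                 - consumption I (node p k) (node p k.+1)].

Definition feasible_schedule p (tau t b : nat -> R) : Prop :=
  [/\ charging_times p tau, path_schedule p tau t b & within_limits p t b].

Definition feasible_path p : Prop :=
  [/\ is_partial_path p, total_demand p <= capacity I &
      exists tau t b, feasible_schedule p tau t b].

Definition min_end_time p : R :=
  least [set e | exists tau t b,
                   feasible_schedule p tau t b /\ e = t (nb_arcs p)].

Definition arc_extends s v : bool := arc I (last_node s) v.

Definition subpath_extends p s : bool :=
  (last_node p == first_node s) &&
  ((last_node p \in stations I) ||
   ((nb_arcs p == 0%N) && (last_node p \in depots I))).

(* Only the values of kappa, mu on depots and of nu on customers matter. *)
Definition reduced_arc_cost (kappa mu nu : V -> R) i j : R :=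
  cost I i j - (i \in depots I)%:R * kappa i - (j \in depots I)%:R * mu j
  - (j \in customers I)%:R * nu j.

Definition reduced_cost (kappa mu nu : V -> R) s : R :=
  \sum_(k < nb_arcs s) reduced_arc_cost kappa mu nu (node s k) (node s k.+1).

End Feasibility.

Section Domination.
Variables (R : realType) (V : finType).

(* dom x y stands for "x dominates y", i.e. every resource of x is at most the
   one of y.  ext x z means that z is an extension of x.  Resources and dom are
   constrained on feasible labels only. *)
Definition domination_relation (feasible : label V -> Prop)
    (ext : label V -> label V -> Prop) (rc : label V -> R)
    (dom : rel (label V)) : Prop :=
  exists (K : finType) (res : K -> label V -> R) (k_cost k_incr : K),
  [/\ forall x, feasible x -> res k_cost x = rc x,
      exists ub, forall x, feasible x -> 0 <= res k_incr x <= ub,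
      forall x z, feasible x -> feasible z -> ext x z ->
        res k_incr x < res k_incr z &
      forall x y, feasible x -> feasible y ->
        dom x y = [&& first_node x == first_node y,
                      last_node x == last_node y &
                      [forall k, res k x <= res k y]]].

Variables (I : instance R V) (kappa mu nu : V -> R).

Definition subpath_domination (dom : rel (label V)) : Prop :=
  domination_relation (feasible_subpath I)
    (fun s s' => exists2 v, arc_extends I s v & s' = extend_arc s v)
    (reduced_cost I kappa mu nu) dom.

Definition path_domination (dom : rel (label V)) : Prop :=
  domination_relation (feasible_path I)
    (fun p p' => exists s, [/\ is_partial_subpath I s, complete_subpath I s,
                              subpath_extends I p s & p' = concat p s])
    (reduced_cost I kappa mu nu) dom.

Definition arc_extension_property (dom : rel (label V)) : Prop :=
  forall s1 s2 v, feasible_subpath I s1 -> feasible_subpath I s2 ->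
    dom s1 s2 -> arc_extends I s1 v -> arc_extends I s2 v ->
    feasible_subpath I (extend_arc s2 v) ->
    feasible_subpath I (extend_arc s1 v) /\
    dom (extend_arc s1 v) (extend_arc s2 v).

Definition subpath_extension_property (dom : rel (label V)) : Prop :=
  forall p1 p2 s, feasible_path I p1 -> feasible_path I p2 -> dom p1 p2 ->
    is_partial_subpath I s -> complete_subpath I s ->
    subpath_extends I p1 s -> subpath_extends I p2 s ->
    feasible_path I (concat p2 s) ->
    feasible_path I (concat p1 s) /\ dom (concat p1 s) (concat p2 s).

End Domination.

Section LabelSetting.
Variables (R : realType) (L : eqType).
Variables (feasible : L -> Prop) (dom : rel L) (key : L -> R)
  (extensions : L -> seq L).

Definition insert_label (gen queue : seq L) (x : L) : seq L :=
  if ~~ `[< feasible x >] || has (fun y => dom y x) (queue ++ gen) then queue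
  else x :: [seq y <- queue | ~~ dom x y].

(* Total correctness of the main loop: every execution from (queue, gen)
   terminates, with a final gen satisfying Post, however one breaks the ties in
   the selection and whatever the order l in which extensions are treated.  The
   hypotheses of the second premise of loop_step are always satisfiable, as a
   nonempty queue has an element with the smallest key. *)
Inductive loop_returns (Post : seq L -> Prop) (queue gen : seq L) : Prop :=
| loop_done of queue = [::] & Post gen
| loop_step of queue <> [::] &
    (forall (x : L) (l : seq L),
       x \in queue -> (forall y, y \in queue -> key x <= key y) ->
       perm_eq l (extensions x) ->
       loop_returns Post
         (foldl (insert_label (x :: gen)) [seq y <- queue | y != x] l)
         (x :: gen)).

End LabelSetting.

Section TwoPhase.
Variables (R : realType) (V : finType) (I : instance R V).

Definition subpath_extensions (s : label V) : seq (label V) :=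
  if complete_subpath I s then [::]
  else [seq extend_arc s v | v <- enum V & arc_extends I s v].

Definition find_subpaths_returns (dom : rel (label V))
    (Post : seq (label V) -> Prop) : Prop :=
  loop_returns (feasible_subpath I) dom (total_travel I) subpath_extensions
    (fun gen => Post [seq s <- gen | complete_subpath I s])
    [seq singleton v | v <- enum (depots I :|: stations I)] [::].

Definition path_extensions (S : seq (label V)) (p : label V) : seq (label V) :=
  if complete_path I p then [::]
  else [seq concat p s | s <- S & subpath_extends I p s].

Definition find_paths_returns (S : seq (label V)) (dom : rel (label V))
    (Post : seq (label V) -> Prop) : Prop :=
  loop_returns (feasible_path I) dom (min_end_time I) (path_extensions S)
    (fun gen => Post [seq p <- gen | complete_path I p])
    [seq singleton v | v <- enum (depots I)] [::].

(* Every execution of the two phases terminates, with an output satisfying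
   Post. *)
Definition two_phase_returns (dom_s dom_p : rel (label V))
    (Post : seq (label V) -> Prop) : Prop :=
  find_subpaths_returns dom_s (fun S => find_paths_returns S dom_p Post).

End TwoPhase.

(* Main.v *)
Require Import Defs.
From mathcomp Require Import all_boot all_order all_algebra.
From mathcomp Require Import all_classical all_reals all_analysis.
From HB Require Import structures.
From mathcomp Require Import ring lra.
Import Order.TTheory GRing.Theory Num.Theory.
Import numFieldNormedType.Exports.
Local Open Scope ring_scope.

(** Neither extension property controls the concatenations of one partial path
    with two different subpaths: a subpath may be dominated by another one that
    cannot be used in its place.  A small situation of this kind has one
    depot D, one client C and one charging station S, with arcs D -> S, S -> C,
    C -> D and S -> D.  Labels are compared by reduced cost and travel time.

    - S C D takes time 2 and S D takes time 3, and both have reduced cost 1, the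
      dual value of the client paying for the detour.  Hence S C D dominates
      S D, which is removed in the first phase
      ([dominates_SCD_SD], [detour_subpath_run]).
    - The client closes at time 1, whereas the station is reached from the depot
      at time 3.  So S C D is feasible as a subpath, but D S C D is infeasible as
      a path, and the second phase returns nothing ([detour_path_run]).
    - The path D S D is feasible, and its reduced cost is 2 minus the dual value
      of the depot as a start, which is M + 2 ([rc_DSD]).

    There are six feasible partial subpaths and three feasible partial paths
    ([detour_feasible_subpath], [detour_feasible_path]).  The only
    distinct comparable labels are S D and S C D, which end at the depot and
    have no feasible extension, so that both extension properties are trivial. *)

(** * Charging at unit rate up to the battery capacity *)

Section CappedCharging.
Local Open Scope classical_set_scope.
Context {R : realType} (B : R).
Hypothesis B0 : 0 <= B.

Let level (x : R) : R := Num.min x B.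

Lemma level_itv x : 0 <= x -> 0 <= level x <= B.
Proof. by move=> x0; rewrite /level le_min x0 B0 ge_min lexx orbT. Qed.

Lemma level_concave :
  convex_function (`[0, +oo[ : set R) (fun x => - level x).
Proof.
move=> t x y _ _; rewrite !convRE.
have t0 : 0 <= t%:num by [].
have t1 : t%:num <= 1 by [].
have [lx ly] : level x <= x /\ level y <= y by rewrite /level !ge_min !lexx.
have [lxB lyB] : level x <= B /\ level y <= B.
  by rewrite /level !ge_min !lexx !orbT.
rewrite !mulrN -opprD lerN2 {3}/level le_min.
have -> : B = t%:num * B + (1 - t%:num) * B by ring.
by apply/andP; split; rewrite lerD // ler_wpM2l // subr_ge0.
Qed.

Lemma level_homo : {in >= 0 &, {homo level : x y / x <= y}}.
Proof. by move=> x y _ _ xy; rewrite /level le_min !ge_min xy lexx orbT. Qed.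

Lemma level_continuous : {within `[0, +oo[, continuous level}.
Proof.
have cont : continuous (level : R^o -> R^o).
  move=> x; apply: (@continuous_min _ _ id (cst B)).
    exact: cvg_id.
  exact: cvg_cst.
exact: continuous_subspaceT.
Qed.

Lemma level_strict x y : 0 <= x -> x < y -> level x < B -> level x < level y.
Proof.
by move=> _ xy; rewrite /level !lt_min !gt_min ltxx orbF => xB; rewrite xy xB.
Qed.

(** The charging function that maps a time x to the minimum of x and B. *)
Definition capped_charging : charging_function B :=
  ChargingFunction level_itv level_concave level_homo (min_l B0)
    level_continuous level_strict (ex_intro2 _ _ B B0 (minxx B)).
End CappedCharging.

Lemma charge_inv_ge0 (R : realType) (B : R) (g : charging_function B) (b : R) :
  0 <= charge_inv g b.
Proof. by rewrite /charge_inv /least; case: xgetP => // x _ [[]]. Qed.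

(** * Label setting up to reordering of the queue *)

Section LabelSettingTheory.
Context {R : realType} {L : eqType}.
Variables (feasible : L -> Prop) (dom : rel L) (key : L -> R).
Variable (extensions : L -> seq L).

Local Notation insert := (insert_label feasible dom).
Local Notation returns := (loop_returns feasible dom key extensions).

Lemma insert_label_perm {gen gen' queue queue' : seq L} {x : L} :
  perm_eq gen gen' -> perm_eq queue queue' ->
  perm_eq (insert gen queue x) (insert gen' queue' x).
Proof.
move=> Eg Eq; rewrite /insert_label (perm_has _ (perm_cat Eq Eg)).
by case: ifP => // _; rewrite perm_cons perm_filter.
Qed.

Lemma foldl_insert_label_perm {gen gen' queue queue' l : seq L} :
  perm_eq gen gen' -> perm_eq queue queue' ->
  perm_eq (foldl (insert gen) queue l) (foldl (insert gen') queue' l).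
Proof.
move=> Eg; elim: l queue queue' => [|x l IHl] //= queue queue' Eq.
exact/IHl/insert_label_perm.
Qed.

(** Whether every execution ends well does not depend on the order in which the
    queue and the generated labels are listed. *)
Lemma loop_returns_perm (Post : seq L -> Prop) (queue gen queue' gen' : seq L) :
  (forall g g', perm_eq g g' -> Post g -> Post g') ->
  perm_eq queue queue' -> perm_eq gen gen' ->
  returns Post queue gen -> returns Post queue' gen'.
Proof.
move=> PostP Eq Eg run; elim: run queue' gen' Eq Eg => {queue gen}.
- move=> queue gen -> Pg queue' gen'; rewrite perm_sym => /perm_nilP -> Eg.
  by apply: loop_done => //; apply: PostP Pg.
move=> queue gen q0 _ IH queue' gen' Eq Eg; apply: loop_step.
  by move=> q'0; apply: q0; apply/perm_nilP; rewrite -q'0.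
move=> x l xq xmin El.
apply: (IH x l); rewrite ?(perm_mem Eq) ?perm_cons //.
- by move=> y; rewrite (perm_mem Eq); apply: xmin.
- by rewrite foldl_insert_label_perm ?perm_cons ?perm_filter.
Qed.

Lemma loop_returns_mono (Post Post' : seq L -> Prop) (queue gen : seq L) :
  (forall g, Post g -> Post' g) ->
  returns Post queue gen -> returns Post' queue gen.
Proof.
move=> PP; elim=> {queue gen} [queue gen q0 Pg|queue gen q0 _ IH].
  exact: loop_done (PP _ Pg).
exact: loop_step.
Qed.
End LabelSettingTheory.

(** * Reduced cost and travel time of a label *)

Section LabelSums.
Context {R : realType} {V : finType}.
Implicit Types (f : V -> V -> R) (x v : V) (l : seq V).

Lemma sum_arcs_nil f x :
  \sum_(k < nb_arcs (x, [::])) f (node (x, [::]) k) (node (x, [::]) k.+1) = 0.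
Proof. by rewrite big_ord0. Qed.

Lemma sum_arcs_cons f x v l :
  \sum_(k < nb_arcs (x, v :: l))
     f (node (x, v :: l) k) (node (x, v :: l) k.+1) =
  f x v + \sum_(k < nb_arcs (v, l)) f (node (v, l) k) (node (v, l) k.+1).
Proof.
rewrite /nb_arcs /= big_ord_recl; congr (_ + _); apply: eq_bigr => k _.
have k_lt := ltn_ord k; rewrite /node lift0 /=.
by congr f; apply: set_nth_default => //=; rewrite ltnW.
Qed.

Variables (I : instance R V) (kappa mu nu : V -> R).

Lemma total_travel_nil x : total_travel I (x, [::]) = 0.
Proof. exact: sum_arcs_nil. Qed.

Lemma total_travel_cons x v l :
  total_travel I (x, v :: l) = travel I x v + total_travel I (v, l).
Proof. exact: sum_arcs_cons. Qed.

Lemma total_travel_extend_arc (s : label V) v :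
  total_travel I (extend_arc s v) =
  total_travel I s + travel I (last_node s) v.
Proof.
case: s => x l; rewrite /extend_arc /last_node /=.
elim: l x => [|w l IHl] x /=; rewrite !total_travel_cons.
  by rewrite !total_travel_nil addrC.
by rewrite IHl addrA.
Qed.

Lemma reduced_cost_nil x : reduced_cost I kappa mu nu (x, [::]) = 0.
Proof. exact: sum_arcs_nil. Qed.

Lemma reduced_cost_cons x v l :
  reduced_cost I kappa mu nu (x, v :: l) =
  reduced_arc_cost I kappa mu nu x v + reduced_cost I kappa mu nu (v, l).
Proof. exact: sum_arcs_cons. Qed.

(** The domination relation whose resources are the reduced cost and the travel
    time, for partial subpaths and partial paths alike. *)
Definition cost_travel_dom : rel (label V) := fun (x y : label V) =>
  [&& first_node x == first_node y, last_node x == last_node y,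
      reduced_cost I kappa mu nu x <= reduced_cost I kappa mu nu y &
      total_travel I x <= total_travel I y].

Lemma cost_travel_dom_refl (x : label V) : cost_travel_dom x x.
Proof. by rewrite /cost_travel_dom !eqxx !lexx. Qed.

Lemma cost_travel_domination (feasible : label V -> Prop)
    (ext : label V -> label V -> Prop) :
  (exists ub, forall x : label V, feasible x -> 0 <= total_travel I x <= ub) ->
  (forall x z : label V, feasible x -> feasible z -> ext x z ->
     total_travel I x < total_travel I z) ->
  domination_relation feasible ext (reduced_cost I kappa mu nu) cost_travel_dom.
Proof.
move=> bounded incr.
exists bool.
exists (fun k => if k then reduced_cost I kappa mu nu else total_travel I).
exists true, false; split=> // x y _ _; congr [&& _, _ & _].
by apply/andP/forallP => [[? ?] []|H] //; split; [exact: H true|exact: H false].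
Qed.
End LabelSums.

(** * The instance *)

Inductive site := Depot | Client | Station.

Definition site_code (v : site) : option bool :=
  match v with Depot => None | Client => Some false | Station => Some true end.
Definition site_decode (c : option bool) : site :=
  match c with None => Depot | Some false => Client | Some true => Station end.
Lemma site_codeK : cancel site_code site_decode. Proof. by case. Qed.
HB.instance Definition _ := Finite.copy site (can_type site_codeK).

Lemma perm_enum_site : perm_eq (enum {: site}) [:: Depot; Client; Station].
Proof. by apply: uniq_perm; rewrite ?enum_uniq // => -[]; rewrite mem_enum. Qed.

Definition detour_arc : rel site := fun i j =>
  match i, j with
  | Depot, Station | Station, Client | Client, Depot | Station, Depot => true
  | _, _ => false
  end.

Section Detour.
Context {R : realType}.

(** The direct return from the station is longer than the detour through the
    client. *)
Definition detour_travel (i j : site) : R :=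
  match i, j with
  | Depot, Station | Station, Depot => 3
  | _, _ => 1
  end.

(** The client closes before a vehicle coming from the depot can reach it. *)
Definition detour_close (v : site) : R := if v is Client then 1 else 10.

Fact detour_cover :
  ([set Client] :|: [set Depot] :|: [set Station])%SET = [set: site]%SET.
Proof. by apply/setP => -[]; rewrite !inE. Qed.

Fact detour_disjoint :
  [&& [disjoint [set Client]%SET & [set Depot]%SET],
      [disjoint [set Client]%SET & [set Station]%SET] &
      [disjoint [set Depot]%SET & [set Station]%SET]].
Proof. by rewrite !disjoints1 !inE. Qed.

Fact detour_window (v : site) :
  [&& (0 : R) <= 0, 0 <= detour_close v & detour_close v <= 10].
Proof. by rewrite lexx; case: v => /=; lra. Qed.

Fact detour_free (v : site) : v \in ([set Depot] :|: [set Station])%SET ->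
  [/\ (0 : R) = 0, (0 : R) = 0 & detour_close v = 10].
Proof. by case: v; rewrite !inE. Qed.

Fact detour_travel_gt0 (i j : site) : detour_arc i j -> 0 < detour_travel i j.
Proof. by case: i; case: j => //= _; lra. Qed.

(** Horizon 10, battery capacity 2 and vehicle capacity 0; every arc costs 1 and
    uses 1 unit of battery, there is no demand, and time windows open at 0. *)
Definition detour : instance R site := Instance
  detour_cover detour_disjoint (ltr0n R 10) (ltr0n R 2) (lexx 0)
  detour_travel_gt0
  (fun i j (_ : detour_arc i j) => ltr01 : 0 < (fun _ _ : site => 1 : R) i j)
  (fun i j (_ : detour_arc i j) => ltr01 : 0 < (fun _ _ : site => 1 : R) i j)
  (fun v => lexx 0 : 0 <= (fun _ : site => 0 : R) v)
  detour_window detour_free (capped_charging 2 (ler0n R 2)).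

(* Labels are named by the initials of their nodes. *)
Local Notation lD := (singleton Depot).
Local Notation lS := (singleton Station).
Local Notation lDS := (Depot, [:: Station]).
Local Notation lSC := (Station, [:: Client]).
Local Notation lSD := (Station, [:: Depot]).
Local Notation lSCD := (Station, [:: Client; Depot]).
Local Notation lDSD := (Depot, [:: Station; Depot]).

(** * Feasible labels *)

Lemma detour_partial_subpath (s : label site) : is_partial_subpath detour s ->
  s \in [:: lD; lS; lDS; lSC; lSD; lSCD].
Proof.
rewrite /is_partial_subpath.
by case: s => [[] [|[] [|[] [|[] s]]]] //=; rewrite !inE //= ?andbF.
Qed.

Lemma detour_feasible_subpath (s : label site) :
  feasible_subpath detour s <-> s \in [:: lD; lS; lDS; lSC; lSD; lSCD].
Proof.
split=> [[/detour_partial_subpath]//|ins]; split.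
- by move: ins; rewrite !inE => /or4P[/eqP->|/eqP->|/eqP->|/or3P[]/eqP->];
    rewrite /is_partial_subpath /= !inE.
- by rewrite /total_demand big1.
(* The vehicle starts at time 0 with a full battery. *)
suff [t tP] : exists t, subpath_schedule detour s t (fun k => 2 - k%:R) /\
    within_limits detour s t (fun k => 2 - k%:R).
  by exists t, (fun k => 2 - k%:R).
move: ins; rewrite !inE => /or4P[/eqP->|/eqP->|/eqP->|/or3P[]/eqP->].
1,2: by exists (nth 0 [::]); split=> [] [|k] //= _; split; lra.
1: exists (nth 0 [:: 0; 3]).
2: exists (nth 0 [:: 0; 1]).
3: exists (nth 0 [:: 0; 3]).
4: exists (nth 0 [:: 0; 1; 2]).
all: by split=> [] [|[|[|k]]] //= _; rewrite /node /= ?max_l; try split; lra.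
Qed.

Lemma detour_feasible_path (p : label site) :
  feasible_path detour p <-> p \in [:: lD; lDS; lDSD].
Proof.
split=> [[pp _ [tau [t [b [tau0 [t0 b0 step] lim]]]]]|inp].
  move: pp tau0 step lim; rewrite /is_partial_path.
  case: p => [[] [|[] [|[] l]]] //=; rewrite ?inE ?andbF //.
    by case: l => [|v l] //=; rewrite !inE ?andbF.
  (* The node sequence starts with D S C: the arrival at C is too late. *)
  move=> _ tau0 step lim; exfalso.
  have [[t1 _] [t2 _]] := (step 0%N isT, step 1%N isT).
  have [[ta0 _] [ta1 _]] := (tau0 0%N isT, tau0 1%N isT).
  have [_ /andP[_]] := lim 2%N isT.
  have t1_ge3 : 3 <= t 1%N.
    by rewrite t1 t0 le_max /node /=; apply/orP; left; lra.
  rewrite /node /= in t2 *; rewrite t2 ge_max => /andP[t2_le1 _].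
  lra.
split.
- by move: inp; rewrite !inE => /or3P[]/eqP->; rewrite /is_partial_path /= !inE.
- by rewrite /total_demand big1.
suff [tau [t [b H]]] : exists tau t b,
    feasible_schedule detour p tau t b by exists tau, t, b.
(* On D S D the vehicle charges for 2 units of time, which fills the battery
   whatever its level on arrival. *)
move: inp; rewrite !inE => /or3P[]/eqP->.
1: exists (nth 0 [:: 0]), (nth 0 [:: 0]), (nth 0 [:: 2]).
2: exists (nth 0 [:: 0]), (nth 0 [:: 0; 3]), (nth 0 [:: 2; 1]).
3: exists (nth 0 [:: 0; 2]), (nth 0 [:: 0; 3; 8]), (nth 0 [:: 2; 1; 1]).
all: split; last (case=> [|[|[|k]]] //= _; rewrite /node /=; split; lra).
all: try by case=> [|[|[|k]]] //= _; rewrite /node /= ?inE.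
all: split=> // [] [|[|[|k]]] //= _; rewrite /node /= !inE /= ?max_l; try lra.
all: split; rewrite ?min_r; try lra.
by have := charge_inv_ge0 _ _ (capped_charging 2 (ler0n R 2)) 1; lra.
Qed.

(** * Reduced costs and domination *)

(** The dual values of the starts of paths.  Those of the ends are 0, and that
    of the client is 1. *)
Definition detour_kappa (M : R) (v : site) : R :=
  if v is Depot then M + 2 else 0.

Local Notation rc M :=
  (reduced_cost detour (detour_kappa M) (fun=> 0) (fun=> 1)).
Local Notation dominates M :=
  (cost_travel_dom detour (detour_kappa M) (fun=> 0) (fun=> 1)).

Definition travel_value :=
  (@total_travel_nil R site detour, @total_travel_cons R site detour).

Lemma dominates_SCD_SD (M : R) : dominates M lSCD lSD.
Proof.
rewrite /cost_travel_dom /first_node /last_node /=.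
rewrite !reduced_cost_cons !reduced_cost_nil !travel_value /reduced_arc_cost /=.
by rewrite !inE /=; apply/andP; split; lra.
Qed.

(** The strictness matters: S C D is generated after S D, and it would be
    discarded if S D dominated it. *)
Lemma SD_not_dominates_SCD (M : R) : dominates M lSD lSCD = false.
Proof.
by rewrite /cost_travel_dom !travel_value /=; apply/negP => /andP[_]; lra.
Qed.

Lemma rc_DSD (M : R) : rc M lDSD = - M.
Proof.
rewrite !reduced_cost_cons reduced_cost_nil /reduced_arc_cost /= !inE /=.
by lra.
Qed.

Lemma detour_subpath_domination (M : R) :
  subpath_domination detour (detour_kappa M) (fun=> 0) (fun=> 1) (dominates M).
Proof.
apply: cost_travel_domination.
- exists 3 => x /detour_feasible_subpath; rewrite !inE.
  by move=> /or4P[/eqP->|/eqP->|/eqP->|/or3P[]/eqP->];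
    rewrite !travel_value /=; lra.
move=> s _ _ _ [v sv ->]; rewrite total_travel_extend_arc ltrDl.
exact: travel_gt0.
Qed.

Lemma detour_path_domination (M : R) :
  path_domination detour (detour_kappa M) (fun=> 0) (fun=> 1) (dominates M).
Proof.
apply: cost_travel_domination.
- exists 6 => x /detour_feasible_path; rewrite !inE.
  by move=> /or3P[]/eqP->; rewrite !travel_value /=; lra.
move=> p p' /detour_feasible_path inp /detour_feasible_path inp'.
move=> [s [_ /andP[s0 _] _ def_p']].
have lt_size : (size p.2 < size p'.2)%N.
  by rewrite def_p' size_cat -[ltnLHS]addn0 ltn_add2l.
move: inp inp' lt_size; rewrite !inE.
by move=> /or3P[]/eqP-> /or3P[]/eqP-> //= _; rewrite !travel_value /=; lra.
Qed.

Lemma detour_arc_extension (M : R) :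
  arc_extension_property detour (dominates M).
Proof.
move=> s1 s2 v /detour_feasible_subpath in1 /detour_feasible_subpath in2.
move=> dom12 _ _ ext2.
suff -> : s1 = s2 by split=> //; apply: cost_travel_dom_refl.
(* Distinct comparable labels are S D and S C D, which no arc extends to a
   feasible label. *)
have := (detour_feasible_subpath _).1 ext2; clear ext2.
move: in1 in2 dom12; rewrite !inE.
by move=> /or4P[/eqP->|/eqP->|/eqP->|/or3P[]/eqP->]
  /or4P[/eqP->|/eqP->|/eqP->|/or3P[]/eqP->] //; case: v.
Qed.

Lemma detour_subpath_extension (M : R) :
  subpath_extension_property detour (dominates M).
Proof.
move=> p1 p2 s /detour_feasible_path in1 /detour_feasible_path in2.
move=> dom12 _ _ ext1 ext2 f2.
suff -> : p1 = p2 by split=> //; apply: cost_travel_dom_refl.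
(* The labels D and D S D have the same ends, but no subpath extends D S D. *)
move: in1 in2 dom12 ext1 ext2; rewrite !inE.
by move=> /or3P[]/eqP-> /or3P[]/eqP-> //;
  rewrite /subpath_extends !inE /= ?andbF.
Qed.

(** * The executions of the two phases *)

Lemma asbool_feasible_subpath (s : label site) :
  `[< feasible_subpath detour s >] =
  (s \in [:: lD; lS; lDS; lSC; lSD; lSCD]).
Proof. by apply/asboolP/idP => /detour_feasible_subpath. Qed.

Lemma asbool_feasible_path (p : label site) :
  `[< feasible_path detour p >] = (p \in [:: lD; lDS; lDSD]).
Proof. by apply/asboolP/idP => /detour_feasible_path. Qed.

(** The extensions in the order D, C, S of the nodes, as the enumeration of the
    nodes is opaque. *)
Lemma perm_detour_subpath_extensions (s : label site) :
  perm_eq (subpath_extensions detour s)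
    (if complete_subpath detour s then [::] else
     [seq extend_arc s v | v <- [:: Depot; Client; Station]
                           & detour_arc (last_node s) v]).
Proof.
rewrite /subpath_extensions; case: ifP => // _.
exact/perm_map/perm_filter/perm_enum_site.
Qed.

Lemma detour_subpath_run (M : R) :
  find_subpaths_returns detour (dominates M)
   (fun S => perm_eq S [:: lDS; lSCD]).
Proof.
rewrite /find_subpaths_returns.
apply: (@loop_returns_mono _ _ _ _ _ _ 
  (perm_eq^~ [:: lDS; lSCD; lSC; lS; lD])) => [g Eg|].
  apply: perm_trans (perm_filter _ Eg) _.
  by rewrite /complete_subpath /last_node /= !inE.
set run := loop_returns _ _ _ _ _.
have run_perm q g q' g' : run q g -> perm_eq q' q -> perm_eq g' g -> run q' g'.
  move=> qg Eq Eg; apply: loop_returns_perm qg; rewrite 1?perm_sym //.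
  by move=> h h' Eh; rewrite (permPl Eh).
(* Apart from the tie between D and S at the beginning, the travel times
   determine the order of selection.  The states are treated backwards. *)
have run4 : run [:: lDS] [:: lSCD; lSC; lS; lD].
  apply: loop_step => // x l; rewrite inE => /eqP-> _.
  move/perm_trans/(_ (perm_detour_subpath_extensions _)).
  rewrite /complete_subpath /= ?inE => /perm_nilP -> /=.
  exact: loop_done.
have run3 : run [:: lSCD; lDS] [:: lSC; lS; lD].
  apply: loop_step => // x l; rewrite !inE => /orP[]/eqP->; last first.
    by move=> /(_ lSCD); rewrite !inE eqxx !travel_value /= => /(_ isT); lra.
  move=> _ /perm_trans/(_ (perm_detour_subpath_extensions _)).
  rewrite /complete_subpath /= ?inE => /perm_nilP -> /=.
  exact: run4.
have run2 : run [:: lSC; lSD; lDS] [:: lS; lD].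
  apply: loop_step => // x l; rewrite !inE => /or3P[]/eqP->; last first.
  - by move=> /(_ lSC); rewrite !inE eqxx !travel_value /= => /(_ isT); lra.
  - by move=> /(_ lSC); rewrite !inE eqxx !travel_value /= => /(_ isT); lra.
  move=> _ /perm_trans/(_ (perm_detour_subpath_extensions _)).
  rewrite /complete_subpath /= ?inE => /perm_small_eq -> //=.
  rewrite /insert_label asbool_feasible_subpath !inE /=.
  rewrite SD_not_dominates_SCD dominates_SCD_SD /=.
  exact: run3.
(* Here D was selected first. *)
have run1 : run [:: lS; lDS] [:: lD].
  apply: loop_step => // x l; rewrite !inE => /orP[]/eqP->; last first.
    by move=> /(_ lS); rewrite !inE eqxx !travel_value /= => /(_ isT); lra.
  move=> _ /perm_trans/(_ (perm_detour_subpath_extensions _)).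
  rewrite -mem_permutations !inE /= => /orP[]/eqP-> /=;
    rewrite /insert_label !asbool_feasible_subpath !inE /=;
    exact: (run_perm _ _ _ _ run2).
(* Here S was selected first. *)
have run1' : run [:: lSC; lSD; lD] [:: lS].
  apply: loop_step => // x l; rewrite !inE => /or3P[]/eqP->.
  - by move=> /(_ lD); rewrite !inE eqxx !orbT !travel_value /= => /(_ isT); lra.
  - by move=> /(_ lD); rewrite !inE eqxx !orbT !travel_value /= => /(_ isT); lra.
  move=> _ /perm_trans/(_ (perm_detour_subpath_extensions _)).
  rewrite /complete_subpath /= ?inE => /perm_small_eq -> //=.
  rewrite /insert_label !asbool_feasible_subpath !inE /=.
  exact: (run_perm _ _ _ _ run2).
have run0 : run [:: lD; lS] [::].
  apply: loop_step => // x l; rewrite !inE => /orP[]/eqP-> _;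
    move=> /perm_trans/(_ (perm_detour_subpath_extensions _));
    rewrite /complete_subpath /= ?inE.
  - move=> /perm_small_eq -> //=.
    rewrite /insert_label !asbool_feasible_subpath !inE /=.
    exact: (run_perm _ _ _ _ run1).
  rewrite -mem_permutations !inE /= => /orP[]/eqP-> /=;
    rewrite /insert_label !asbool_feasible_subpath !inE /=;
    exact: (run_perm _ _ _ _ run1').
apply: (run_perm _ _ _ _ run0) => //.
have enumDS : perm_eq (enum (depots detour :|: stations detour)%SET)
    [:: Depot; Station].
  by apply: uniq_perm; rewrite ?enum_uniq // => -[]; rewrite mem_enum !inE.
exact: (perm_map (@singleton site) enumDS).
Qed.

(** The second phase returns the empty list: its input does not contain S D, and
    the only extension of D S that remains is the infeasible D S C D. *)
Lemma detour_path_run (M : R) (S : seq (label site)) :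
  perm_eq S [:: lDS; lSCD] ->
  find_paths_returns detour S (dominates M) (eq^~ [::]).
Proof.
move=> ES; rewrite /find_paths_returns.
have ext_perm p : perm_eq (path_extensions detour S p)
    (if complete_path detour p then [::] else
     [seq concat p s | s <- [:: lDS; lSCD] & subpath_extends detour p s]).
  by rewrite /path_extensions; case: ifP => // _; apply/perm_map/perm_filter.
have -> : enum (depots detour) = [:: Depot].
  apply: perm_small_eq => //; apply: uniq_perm; rewrite ?enum_uniq // => -[];
    by rewrite mem_enum !inE.
apply: loop_step => // x l; rewrite inE => /eqP-> _.
move=> /perm_trans/(_ (ext_perm _)).
rewrite /complete_path /subpath_extends /= !inE /= => /perm_small_eq -> //=.
rewrite /insert_label asbool_feasible_path !inE /=.
apply: loop_step => // {}x {}l; rewrite inE => /eqP-> _.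
move=> /perm_trans/(_ (ext_perm _)).
rewrite /complete_path /subpath_extends /= !inE /= => /perm_small_eq -> //=.
rewrite /insert_label asbool_feasible_path !inE /=.
by apply: loop_done => //=; rewrite /complete_path /= !inE.
Qed.
End Detour.

Theorem proposition5 (R : realType) (M : R) (hM : 0 < M) :
  exists (V : finType) (I : instance R V) (kappa mu nu : V -> R)
         (dom_s dom_p : rel (label V)),
    subpath_domination I kappa mu nu dom_s /\
    path_domination I kappa mu nu dom_p /\
    arc_extension_property I dom_s /\
    subpath_extension_property I dom_p /\
    (exists p : label V,
       [/\ feasible_path I p, complete_path I p &
           reduced_cost I kappa mu nu p <= - M]) /\
    two_phase_returns I dom_s dom_p
      (fun P : seq (label V) =>
         forall p, p \in P -> 0 <= reduced_cost I kappa mu nu p).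
Proof.
exists site, detour, (detour_kappa M), (fun=> 0), (fun=> 1).
set dom := cost_travel_dom detour (detour_kappa M) (fun=> 0) (fun=> 1).
exists dom, dom; split; first exact: detour_subpath_domination.
split; first exact: detour_path_domination.
split; first exact: detour_arc_extension.
split; first exact: detour_subpath_extension.
split.
  exists (Depot, [:: Station; Depot]); split.
  - by apply/detour_feasible_path; rewrite !inE eqxx !orbT.
  - by rewrite /complete_path /= !inE.
  - by rewrite rc_DSD.
apply: loop_returns_mono; last exact: detour_subpath_run M.
move=> g /(detour_path_run M); apply: loop_returns_mono => h -> p.
by rewrite in_nil.
Qed.
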